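(* Write $Z_\sigma$ for $Z_\sigma(\alpha,\beta,\gamma,0;q)$. For arbitrary (possibly empty) words $\sigma,\sigma_1,\sigma_2$ in the alphabet $\{\bullet,\circ\}$, $$Z_{\sigma_1\bullet\circ\sigma_2}=qZ_{\sigma_1\circ\bullet\sigma_2}+\alpha\beta\,(Z_{\sigma_1\bullet\sigma_2}+Z_{\sigma_1\circ\sigma_2}),$$ $$\alpha Z_{\circ\sigma}=\gamma Z_{\bullet\sigma}+\alpha\beta Z_{\sigma},$$ $$Z_{\sigma\bullet}=\alpha Z_\sigma.$$
   Context: A staircase tableau of size $n$ is a filling of the Young diagram of staircase shape $(n,n-1,\dots,1)$ (English convention: row $r$ consists of columns $1,\dots,n+1-r$; the diagonal boxes are the last boxes of the rows) in which each box is empty or labeled by one of $\alpha,\beta,\gamma,\delta$, such that: no diagonal box is empty; every box in the same row and to the left of a $\beta$ or a $\delta$ is empty; every box in the same column and above an $\alpha$ or a $\gamma$ is empty. (For $n=0$ there is a single empty tableau of weight $1$.) The type of $T$ is the word in $\{\bullet,\circ\}^n$ obtained by reading the diagonal boxes from northeast to southwest, writing $\bullet$ for $\alpha$ or $\delta$ and $\circ$ for $\beta$ or $\gamma$. Each empty box is assigned $q$ or $1$ according to the nearest labeled box to its right in its row and the nearest labeled box below it in its column: it gets $1$ if it sees a $\beta$ to its right; $q$ if it sees a $\delta$ to its right; $1$ if it sees an $\alpha$ or $\gamma$ to its right and an $\alpha$ or $\delta$ below it; $q$ if it sees an $\alpha$ or $\gamma$ to its right and a $\beta$ or $\gamma$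 below it. The weight $\mathrm{wt}(T)$ is the product of all labels $\alpha,\beta,\gamma,\delta$ in $T$ and all assigned $q$'s. For a word $\sigma$, $Z_\sigma(\alpha,\beta,\gamma,\delta;q)=\sum_T\mathrm{wt}(T)$ over staircase tableaux of type $\sigma$; setting $\delta=0$ amounts to summing over tableaux containing no $\delta$. *)

(* Defs.v *)
From HB Require Import structures.
From mathcomp Require Import all_boot all_order all_algebra.

Set Implicit Arguments.
Unset Strict Implicit.
Unset Printing Implicit Defensive.

Import GRing.Theory.
Local Open Scope ring_scope.

Inductive label := Alpha | Beta | Gamma | Delta.

Definition label_code (l : label) : bool * bool :=
  match l with
  | Alpha => (true, true) | Beta => (false, true)
  | Gamma => (false, false) | Delta => (true, false)
  end.

Definition label_decode (c : bool * bool) : label :=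
  match c with
  | (true, true) => Alpha | (false, true) => Beta
  | (false, false) => Gamma | (true, false) => Delta
  end.

Lemma label_codeK : cancel label_code label_decode.
Proof. by case. Qed.

HB.instance Definition _ := Finite.copy label (can_type label_codeK).

Definition word := seq bool.
Notation bullet := true (only parsing).
Notation circ := false (only parsing).

(* Rows and columns are numbered from 0, so the staircase shape
   (n, n-1, ..., 1) consists of the boxes (i, j) with i + j < n, and the
   diagonal box of row i is (i, n-1-i) = (i, rev_ord i).  A filling is defined
   on the whole n x n square; staircase_tableau forces it to be empty (None)
   outside the shape. *)
Definition in_shape n (p : 'I_n * 'I_n) : bool := (p.1 + p.2 < n)%N.

Definition filling n := {ffun 'I_n * 'I_n -> option label}.

Definition staircase_tableau n (T : filling n) : bool :=
  [&& [forall p, ~~ in_shape p ==> (T p == None)],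
      [forall i, T (i, rev_ord i) != None],
      [forall i : 'I_n, forall j : 'I_n, forall k : 'I_n,
         (j < k)%N && (T (i, k) \in [:: Some Beta; Some Delta])
           ==> (T (i, j) == None)]
    & [forall i : 'I_n, forall k : 'I_n, forall j : 'I_n,
         (i < k)%N && (T (k, j) \in [:: Some Alpha; Some Gamma])
           ==> (T (i, j) == None)]].

Definition label_type (l : label) : bool :=
  match l with
  | Alpha | Delta => bullet
  | Beta | Gamma => circ
  end.

(* pmap skips empty diagonal boxes, which staircase tableaux do not have. *)
Definition tableau_type n (T : filling n) : word :=
  pmap (fun i => omap label_type (T (i, rev_ord i))) (enum 'I_n).

Definition nearest_right n (T : filling n) (i j : 'I_n) : option label :=
  ohead (pmap (fun k => T (i, k)) [seq k : 'I_n <- enum 'I_n | (j < k)%N]).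

Definition nearest_below n (T : filling n) (i j : 'I_n) : option label :=
  ohead (pmap (fun k => T (k, j)) [seq k : 'I_n <- enum 'I_n | (i < k)%N]).

Section Weight.
Variables (R : comNzRingType) (al be ga de q : R).

Definition label_weight (l : label) : R :=
  match l with
  | Alpha => al | Beta => be | Gamma => ga | Delta => de
  end.

(* In a staircase tableau an empty box of the shape is not on the diagonal, so
   it sees a label in both directions and the last case does not occur. *)
Definition empty_weight (right below : option label) : R :=
  match right, below with
  | Some Beta, _ => 1
  | Some Delta, _ => q
  | Some (Alpha | Gamma), Some (Alpha | Delta) => 1
  | Some (Alpha | Gamma), Some (Beta | Gamma) => q
  | _, _ => 1
  end.

Definition box_weight n (T : filling n) (p : 'I_n * 'I_n) : R :=
  match T p with
  | Some l => label_weight l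
  | None => empty_weight (nearest_right T p.1 p.2) (nearest_below T p.1 p.2)
  end.

Definition tableau_weight n (T : filling n) : R :=
  \prod_(p : 'I_n * 'I_n | in_shape p) box_weight T p.

Definition Z (s : word) : R :=
  \sum_(T : filling (size s) | staircase_tableau T && (tableau_type T == s))
    tableau_weight T.

End Weight.

(* Main.v *)
(* Build a tableau of type s b from one of type s by adding a leftmost column,
   whose bottom box is the new diagonal box.  The weight of the column depends
   on the old tableau only through its number k of live rows, those whose
   leftmost label is alpha or gamma: the other rows start with a beta, so their
   new box is empty of weight 1.  Hence appending a letter acts on functions of
   k by a transfer operator, and Z of a word is its product of operators applied
   to 1, at k = 0.  Under a bottom beta the lowest live row of the new column is
   either empty (factor q), or beta (the row dies), or alpha or gamma (everything
   above it is empty); this recursion gives D E = q E D + al be (D + E), and the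
   other two identities are read off at the two ends of the product. *)

Require Import Defs.
From mathcomp Require Import all_boot all_order all_algebra.
From mathcomp Require Import ring.

Set Implicit Arguments.
Unset Strict Implicit.
Unset Printing Implicit Defensive.

Import GRing.Theory.
Local Open Scope ring_scope.

(** * Indices of the enlarged staircase *)

Lemma widen_ord_lift_max n (i : 'I_n) :
  widen_ord (leqnSn n) i = lift ord_max i.
Proof. by apply/val_inj; rewrite /= /bump leqNgt ltn_ord. Qed.

Lemma enum_ord_rcons n :
  enum 'I_n.+1 = rcons (map (lift ord_max) (enum 'I_n)) ord_max.
Proof.
by rewrite enum_ordSr; congr rcons; apply: eq_map => i; rewrite widen_ord_lift_max.
Qed.

Lemma big_ord_recr_lift (S : Type) (idx : S) (op : Monoid.law idx) n
    (F : 'I_n.+1 -> S) :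
  \big[op/idx]_(i < n.+1) F i =
  op (\big[op/idx]_(i < n) F (lift ord_max i)) (F ord_max).
Proof.
by rewrite big_ord_recr; congr (op _ _); apply: eq_bigr => i _; rewrite widen_ord_lift_max.
Qed.

Lemma ord_sorted n : sorted (fun i j : 'I_n => (i < j)%N) (enum 'I_n).
Proof.
have := iota_ltn_sorted 0 n; rewrite -val_enum_ord sorted_map.
by apply: sub_sorted.
Qed.

Lemma rev_ord_lift_max n (i : 'I_n) :
  rev_ord (lift ord_max i) = lift ord0 (rev_ord i).
Proof.
by rewrite -widen_ord_lift_max; apply/val_inj; rewrite /= /bump /= add1n subSS subnSK.
Qed.

Lemma rev_ord_max n : rev_ord ord_max = ord0 :> 'I_n.+1.
Proof. by apply/val_inj; rewrite /= subnn. Qed.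

(** The new row comes last and the new column first, so the old box [(i, j)] becomes
    [(lift ord_max i, lift ord0 j)]. On diagonal boxes this is [rev_ord_lift_max]. *)
Lemma in_shape_lift n (i j : 'I_n) :
  in_shape (lift ord_max i, lift ord0 j) = in_shape (i, j).
Proof. by rewrite -widen_ord_lift_max /in_shape /= /bump /= add1n addnS ltnS. Qed.

Lemma in_shape_max n (j : 'I_n) : ~~ in_shape (@ord_max n, lift ord0 j).
Proof. by rewrite /in_shape [X in (_ + X < _)%N]lift0 -leqNgt addnS ltnS leq_addr. Qed.

(** * Labels seen along a row or a column *)

Definition first_label n (f : 'I_n -> option label) : option label :=
  ohead (pmap f (enum 'I_n)).

(** Common form of [nearest_right] and [nearest_below], which are convertible to it for [f] a row or
    a column. *)
Definition next_label n (f : 'I_n -> option label) (i : 'I_n) : option label :=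
  ohead (pmap f [seq k : 'I_n <- enum 'I_n | (i < k)%N]).

Lemma eq_first_label n (f g : 'I_n -> option label) :
  f =1 g -> first_label f = first_label g.
Proof. by move=> fg; rewrite /first_label (eq_pmap fg). Qed.

Lemma eq_next_label n (f g : 'I_n -> option label) i :
  f =1 g -> next_label f i = next_label g i.
Proof. by move=> fg; rewrite /next_label (eq_pmap fg). Qed.

Lemma pmap_map (A B C : Type) (f : B -> option C) (g : A -> B) s :
  pmap f (map g s) = pmap (f \o g) s.
Proof. by elim: s => //= x s ->. Qed.

Lemma first_label0 n (f : 'I_n.+1 -> option label) :
  first_label f =
  if f ord0 is Some l then Some l else first_label (f \o lift ord0).
Proof.
rewrite /first_label enum_ordSl /= pmap_map.
by case: (f ord0).
Qed.

Lemma next_label0 n (f : 'I_n.+1 -> option label) :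
  next_label f ord0 = first_label (f \o lift ord0).
Proof.
rewrite /next_label enum_ordSl /= filter_map pmap_map; congr (ohead (pmap _ _)).
by apply/all_filterP/allP.
Qed.

Lemma next_label_lift0 n (f : 'I_n.+1 -> option label) i :
  next_label f (lift ord0 i) = next_label (f \o lift ord0) i.
Proof.
by rewrite /next_label enum_ordSl /= filter_map pmap_map.
Qed.

Lemma next_label_lift_max n (f : 'I_n.+1 -> option label) i :
  next_label f (lift ord_max i) =
  if next_label (f \o lift ord_max) i is Some l then Some l else f ord_max.
Proof.
rewrite /next_label enum_ord_rcons filter_rcons (_ : (_ < _)%N); last first.
  by rewrite lift_max.
rewrite -cats1 pmap_cat filter_map pmap_map.
rewrite (eq_filter (a2 := fun k : 'I_n => (i < k)%N)) => [|k]; last first.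
  by rewrite inE !lift_max.
by case: (pmap _ _) => //=; case: (f ord_max).
Qed.

Lemma next_label_max n (f : 'I_n.+1 -> option label) : next_label f ord_max = None.
Proof.
rewrite /next_label (eq_filter (a2 := pred0)) ?filter_pred0 // => k.
by rewrite ltnNge leq_ord.
Qed.

Lemma first_label_eq n (f : 'I_n -> option label) (k : 'I_n) :
  (forall j : 'I_n, (j < k)%N -> f j = None) -> f k != None -> first_label f = f k.
Proof.
move=> fN fk; rewrite /first_label.
have : k \in enum 'I_n by rewrite mem_enum.
elim: (enum 'I_n) (ord_sorted n) => //= x s IHs xs.
have ltP : all (fun j : 'I_n => (x < j)%N) s.
  by apply: order_path_min xs => a b c; apply: ltn_trans.
rewrite inE => /predU1P[<-|ks]; first by case: (f k) fk.
rewrite fN ?(allP ltP) //=; apply: IHs ks; exact: path_sorted xs.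
Qed.

Lemma first_label_mem n (f : 'I_n -> option label) l :
  first_label f = Some l -> exists k, f k = Some l.
Proof.
rewrite /first_label; elim: (enum 'I_n) => //= x s IHs.
by case fx: (f x) => [l'|//] [<-]; exists x.
Qed.

(** Columns are taken apart from the bottom, because the constraints and the weight of a box depend
    on what lies below it. *)
Definition snoc n (X : finType) (c : {ffun 'I_n -> X}) (x : X) :
    {ffun 'I_n.+1 -> X} :=
  [ffun i => if unlift ord_max i is Some j then c j else x].

Lemma snoc_max n (X : finType) (c : {ffun 'I_n -> X}) x : snoc c x ord_max = x.
Proof. by rewrite ffunE unlift_none. Qed.

Lemma snoc_lift n (X : finType) (c : {ffun 'I_n -> X}) x i :
  snoc c x (lift ord_max i) = c i.
Proof. by rewrite ffunE liftK. Qed.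

Lemma sum_snoc (V : nmodType) n (X : finType) (F : {ffun 'I_n.+1 -> X} -> V) :
  \sum_c F c = \sum_x \sum_c F (snoc c x).
Proof.
rewrite pair_big /= (reindex (fun p : X * {ffun 'I_n -> X} => snoc p.2 p.1)) //=.
exists (fun c : {ffun 'I_n.+1 -> X} => (c ord_max, [ffun i => c (lift ord_max i)])) => [[x c] _|c _] /=.
  by rewrite snoc_max; congr (_, _); apply/ffunP => i; rewrite ffunE snoc_lift.
by apply/ffunP => i; rewrite ffunE; case: unliftP => [j|] -> //; rewrite ffunE.
Qed.

(** * Staircase tableaux and their live rows *)

Definition dead_labels := [:: Some Beta; Some Delta].
Definition stop_labels := [:: Some Alpha; Some Gamma].

Lemma staircaseP n (T : filling n) :
  reflect [/\ forall p, ~~ in_shape p -> T p = None,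
              forall i, T (i, rev_ord i) != None,
              forall i j k : 'I_n, (j < k)%N -> T (i, k) \in dead_labels -> T (i, j) = None
            & forall i k j : 'I_n, (i < k)%N -> T (k, j) \in stop_labels -> T (i, j) = None]
          (staircase_tableau T).
Proof.
apply: (iffP and4P) => [[h1 h2 h3 h4]|[h1 h2 h3 h4]]; split.
- by move=> p np; apply/eqP; apply: (implyP (forallP h1 p)).
- by move=> i; apply: (forallP h2).
- move=> i j k jk Tk; apply/eqP.
  by have /forallP/(_ j)/forallP/(_ k)/implyP := forallP h3 i; apply; rewrite jk.
- move=> i k j ik Tk; apply/eqP.
  by have /forallP/(_ k)/forallP/(_ j)/implyP := forallP h4 i; apply; rewrite ik.
- by apply/forallP => p; apply/implyP => /h1->.
- by apply/forallP.
- apply/forallP => i; apply/forallP => j; apply/forallP => k.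
  by apply/implyP => /andP[jk Tk]; apply/eqP; apply: h3 jk Tk.
- apply/forallP => i; apply/forallP => k; apply/forallP => j.
  by apply/implyP => /andP[ik Tk]; apply/eqP; apply: h4 ik Tk.
Qed.

Definition row_label n (T : filling n) (i : 'I_n) : option label :=
  first_label (fun j => T (i, j)).

Definition live n (T : filling n) (i : 'I_n) : bool :=
  row_label T i \notin dead_labels.

Lemma row_label_neq_None n (T : filling n) i :
  staircase_tableau T -> row_label T i != None.
Proof.
case/staircaseP=> _ /(_ i) Ti _ _; rewrite /row_label /first_label.
have : rev_ord i \in enum 'I_n by rewrite mem_enum.
elim: (enum 'I_n) => //= x s IHs; rewrite inE => /predU1P[<-|/IHs].
  by case: (T _) Ti.
by case: (T _).
Qed.

(** Everything to the left of a beta or a delta is empty, so such a label is always the leftmost one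
    of its row. *)
Lemma live_dead n (T : filling n) (i k : 'I_n) :
  staircase_tableau T -> T (i, k) \in dead_labels -> live T i = false.
Proof.
case/staircaseP=> _ _ Trow _ Tk; apply/negbF.
rewrite /row_label (first_label_eq (k := k)) // => [j jk|].
  exact: Trow jk Tk.
by case: (T _) Tk.
Qed.

(** * Adding a leftmost column *)

Definition add_column n (T : filling n) (c : {ffun 'I_n.+1 -> option label}) :
    filling n.+1 :=
  [ffun p => if unlift ord0 p.2 is Some j then
               if unlift ord_max p.1 is Some i then T (i, j) else None
             else c p.1].

Lemma add_column0 n (T : filling n) c i : add_column T c (i, ord0) = c i.
Proof. by rewrite ffunE /= unlift_none. Qed.

Lemma add_column_lift n (T : filling n) c i j :
  add_column T c (lift ord_max i, lift ord0 j) = T (i, j).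
Proof. by rewrite ffunE /= !liftK. Qed.

Lemma add_column_max n (T : filling n) c j :
  add_column T c (ord_max, lift ord0 j) = None.
Proof. by rewrite ffunE /= !liftK unlift_none. Qed.

(* [a] is the label below the column and [L] tells which rows are live. *)
Definition column_ok n (L : 'I_n -> bool) (a : label) (c : {ffun 'I_n -> option label}) :=
  [&& [forall i, (c i != None) ==> L i],
      [forall i : 'I_n, forall k : 'I_n,
         (i < k)%N && (c k \in stop_labels) ==> (c i == None)]
    & (Some a \in stop_labels) ==> [forall i, c i == None]].

Lemma column_okP n (L : 'I_n -> bool) a (c : {ffun 'I_n -> option label}) :
  reflect [/\ forall i, c i != None -> L i,
              forall i k : 'I_n, (i < k)%N -> c k \in stop_labels -> c i = None
            & Some a \in stop_labels -> forall i, c i = None]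
          (column_ok L a c).
Proof.
apply: (iffP and3P) => [[h1 h2 h3]|[h1 h2 h3]]; split.
- by move=> i; apply/implyP/(forallP h1).
- move=> i k ik ck; apply/eqP.
  by have /forallP/(_ k)/implyP := forallP h2 i; apply; rewrite ik.
- by move=> /(implyP h3)/forallP h i; apply/eqP.
- by apply/forallP => i; apply/implyP/h1.
- apply/forallP => i; apply/forallP => k.
  by apply/implyP => /andP[ik ck]; apply/eqP; apply: h2 ik ck.
- by apply/implyP => /h3 h; apply/forallP => i; apply/eqP.
Qed.

(** Once the lowest entry [x] is removed, the label below the rest is [x] if there is one and still
    [a] otherwise, that is, [odflt a x]. *)
Lemma column_ok_snoc n (L : 'I_n.+1 -> bool) a (c : {ffun 'I_n -> option label}) x :
  column_ok L a (snoc c x) =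
  [&& (x != None) ==> L ord_max, (Some a \in stop_labels) ==> (x == None)
    & column_ok (L \o lift ord_max) (odflt a x) c].
Proof.
apply/column_okP/and3P => [[h1 h2 h3]|[g1 g2 /column_okP[h1 h2 h3]]]; split.
- by apply/implyP; have := h1 ord_max; rewrite snoc_max.
- by apply/implyP => /h3 /(_ ord_max); rewrite snoc_max => ->.
- apply/column_okP; split.
  + by move=> i; have := h1 (lift ord_max i); rewrite snoc_lift.
  + move=> i k ik; have := h2 (lift ord_max i) (lift ord_max k).
    by rewrite !snoc_lift; apply; rewrite !lift_max.
  (* For a labeled [x], the condition on the label below is the column condition at the bottom box;
     for an empty [x] it is inherited from [a]. *)
  + case: x h1 h2 h3 => [l|] h1 h2 h3 /= al i; last first.
      by have := h3 al (lift ord_max i); rewrite snoc_lift.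
    have := h2 (lift ord_max i) ord_max; rewrite snoc_lift snoc_max.
    by apply=> //; rewrite lift_max.
- move=> i; case: (unliftP ord_max i) => [j ->|->]; first by rewrite snoc_lift; apply: h1.
  by rewrite snoc_max; apply/implyP.
- move=> i k; case: (unliftP ord_max k) => [k' ->|->]; last first.
    case: (unliftP ord_max i) => [j ->|->]; last by rewrite ltnn.
    by rewrite snoc_max snoc_lift => _; case: x h3 {g1 g2} => //= l h3 /h3.
  case: (unliftP ord_max i) => [j ->|->]; last first.
    by rewrite lift_max ltnNge (ltnW (ltn_ord _)).
  rewrite !lift_max !snoc_lift; exact: h2.
- move=> al i; case: (unliftP ord_max i) => [j ->|->]; last first.
    by rewrite snoc_max; apply/eqP/(implyP g2).
  by rewrite snoc_lift; move/(implyP g2)/eqP: (al) h3 => -> h3; apply: h3.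
Qed.

(** Nothing lies to the left of the new column, so the only new row constraint is that dead rows get
    an empty box. The default [Alpha] is never reached, since [x] is a diagonal box. *)
Lemma staircase_add_column n (T : filling n) (c : {ffun 'I_n -> option label}) x :
  staircase_tableau (add_column T (snoc c x)) =
  [&& staircase_tableau T, x != None & column_ok (live T) (odflt Alpha x) c].
Proof.
apply/idP/and3P => [/staircaseP[h1 h2 h3 h4]|[sT xN /column_okP[g1 g2 g3]]].
  have sT : staircase_tableau T.
    apply/staircaseP; split.
    - move=> [i j] ij; rewrite -(add_column_lift T (snoc c x)); apply: h1.
      by rewrite in_shape_lift.
    - move=> i; have := h2 (lift ord_max i).
      by rewrite rev_ord_lift_max add_column_lift.
    - move=> i j k jk; rewrite -!(add_column_lift T (snoc c x)); apply: h3.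
      by rewrite /= /bump /= !add1n.
    - move=> i k j ik; rewrite -!(add_column_lift T (snoc c x)); apply: h4.
      by rewrite !lift_max.
  have xN : x != None.
    have := h2 ord_max.
    by rewrite rev_ord_max add_column0 snoc_max.
  split=> //; apply/column_okP; split.
  (* The leftmost label of a dead row lies to the right of the new box and forces it to be empty. *)
  - move=> i; apply: contraR; rewrite negbK => dead.
    have [l Tl] : exists l, row_label T i = Some l.
      by case: (row_label T i) dead => // l; exists l.
    rewrite Tl in dead; have [k Tk] := first_label_mem Tl.
    apply/eqP; have := h3 (lift ord_max i) ord0 (lift ord0 k).
    by rewrite add_column_lift add_column0 snoc_lift Tk; apply.
  - move=> i k ik; have := h4 (lift ord_max i) (lift ord_max k) ord0.
    by rewrite !add_column0 !snoc_lift; apply; rewrite !lift_max.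
  - move=> xs i; have := h4 (lift ord_max i) ord_max ord0.
    rewrite !add_column0 snoc_lift snoc_max; apply; first by rewrite lift_max.
    by case: x xs xN {h1 h2 h3 h4}.
have /staircaseP[h1 h2 h3 h4] := sT.
apply/staircaseP; split.
- move=> [i j]; case: (unliftP ord0 j) => [j' ->|->]; last first.
    by rewrite /in_shape /= addn0 ltn_ord.
  case: (unliftP ord_max i) => [i' ->|-> _]; last exact: add_column_max.
  by rewrite add_column_lift in_shape_lift; apply: h1.
- move=> i; case: (unliftP ord_max i) => [i' ->|->].
    by rewrite rev_ord_lift_max add_column_lift.
  by rewrite rev_ord_max add_column0 snoc_max.
- move=> i j k; case: (unliftP ord0 k) => [k' ->|->]; last by [].
  case: (unliftP ord_max i) => [i' ->|->]; last by rewrite add_column_max.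
  rewrite add_column_lift => jk Tk.
  case: (unliftP ord0 j) jk => [j' ->|-> _].
    by rewrite add_column_lift /= /bump /= !add1n => jk; apply: h3 jk Tk.
  (* A label in the new box would make the row live, against [live_dead]. *)
  rewrite add_column0 snoc_lift; apply/eqP; apply: contraFT (live_dead sT Tk).
  exact: g1.
- move=> i k j ik; case: (unliftP ord0 j) => [j' ->|->].
    case: (unliftP ord_max k) ik => [k' ->|->]; last by rewrite add_column_max.
    case: (unliftP ord_max i) => [i' ->|->]; last by rewrite add_column_max.
    by rewrite !add_column_lift !lift_max; apply: h4.
  rewrite !add_column0; case: (unliftP ord_max k) ik => [k' ->|->].
    case: (unliftP ord_max i) => [i' ->|->].
      by rewrite !snoc_lift !lift_max; apply: g2.
    by rewrite lift_max ltnNge (ltnW (ltn_ord _)).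
  case: (unliftP ord_max i) => [i' -> _|->]; last by rewrite ltnn.
  rewrite snoc_max snoc_lift => xs; apply: g3.
  by case: x xs xN.
Qed.

Lemma type_add_column n (T : filling n) (c : {ffun 'I_n -> option label}) l :
  tableau_type (add_column T (snoc c (Some l))) = rcons (tableau_type T) (label_type l).
Proof.
rewrite /tableau_type enum_ord_rcons -cats1 pmap_cat pmap_map -cats1; congr (_ ++ _).
  apply: eq_pmap => i /=.
  by rewrite rev_ord_lift_max add_column_lift.
by rewrite /= rev_ord_max add_column0 snoc_max.
Qed.

Lemma row_label_lift n (T : filling n) c i :
  row_label (add_column T c) (lift ord_max i) =
  if c (lift ord_max i) is Some l then Some l else row_label T i.
Proof.
rewrite /row_label first_label0 add_column0; case: (c _) => //.
by apply: eq_first_label => j /=; rewrite add_column_lift.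
Qed.

Lemma row_label_max n (T : filling n) c :
  row_label (add_column T c) ord_max = c ord_max.
Proof.
rewrite /row_label first_label0 add_column0; case: (c _) => //.
case E: (first_label _) => [l|//].
by have [k /=] := first_label_mem E; rewrite add_column_max.
Qed.

Lemma nearest_right_lift n (T : filling n) c i j :
  nearest_right (add_column T c) (lift ord_max i) (lift ord0 j) = nearest_right T i j.
Proof.
rewrite -[LHS]/(next_label _ _) next_label_lift0.
by apply: eq_next_label => k /=; rewrite add_column_lift.
Qed.

Lemma nearest_right0 n (T : filling n) c i :
  nearest_right (add_column T c) (lift ord_max i) ord0 = row_label T i.
Proof.
rewrite -[LHS]/(next_label _ _) next_label0.
by apply: eq_first_label => k /=; rewrite add_column_lift.
Qed.

(** The bottom row is empty outside the new column, so old boxes see nothing new below them. *)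
Lemma nearest_below_lift n (T : filling n) c i j :
  nearest_below (add_column T c) (lift ord_max i) (lift ord0 j) = nearest_below T i j.
Proof.
rewrite -[LHS]/(next_label (fun k => add_column T c (k, lift ord0 j)) _).
rewrite next_label_lift_max add_column_max.
rewrite (eq_next_label (g := fun k => T (k, j))) => [|k /=]; last by rewrite add_column_lift.
by rewrite -[RHS]/(next_label (fun k => T (k, j)) i); case: next_label.
Qed.

Lemma nearest_below0 n (T : filling n) (c : {ffun 'I_n -> option label}) l i :
  nearest_below (add_column T (snoc c (Some l))) (lift ord_max i) ord0 =
  Some (odflt l (next_label c i)).
Proof.
rewrite -[LHS]/(next_label (fun k => add_column T (snoc c (Some l)) (k, ord0)) _).
rewrite next_label_lift_max add_column0 snoc_max.
rewrite (eq_next_label (g := c)) => [|k /=]; last by rewrite add_column0 snoc_lift.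
by case: next_label.
Qed.

(** * Sums over the fillings of one column *)

Lemma sum_option_label (V : nmodType) (F : option label -> V) :
  \sum_x F x =
  F None + (F (Some Alpha) + (F (Some Beta) + (F (Some Gamma) + F (Some Delta)))).
Proof.
rewrite (bigD1 None) // (bigD1 (Some Alpha)) // (bigD1 (Some Beta)) //.
rewrite (bigD1 (Some Gamma)) // (bigD1 (Some Delta)) //= big_pred0 ?addr0 //.
by case=> [[]|].
Qed.

Section Transfer.
Variables (R : comNzRingType) (al be ga q : R).

(** An empty box in a live row sees an alpha or a gamma to its right, so its weight is decided by
    the type of the label below. *)
Definition column_box_weight (L : bool) (below : label) (x : option label) : R :=
  if x is Some l then label_weight al be ga 0 l
  else if L && ~~ label_type below then q else 1.

Definition column_weight n (L : 'I_n -> bool) a (c : {ffun 'I_n -> option label}) : R :=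
  \prod_i column_box_weight (L i) (odflt a (next_label c i)) (c i).

Definition live_after (L : bool) (x : option label) : bool :=
  if x is Some l then Some l \notin dead_labels else L.

(** The test function [phi] of the new number of live rows stands for the contribution of the
    columns still to be added. *)
Definition column_sum n (L : 'I_n -> bool) a (phi : nat -> R) : R :=
  \sum_(c | column_ok L a c)
     column_weight L a c * phi (\sum_i live_after (L i) (c i))%N.

Lemma column_weight_snoc n (L : 'I_n.+1 -> bool) a c x :
  column_weight L a (snoc c x) =
  column_box_weight (L ord_max) a x *
  column_weight (L \o lift ord_max) (odflt a x) c.
Proof.
rewrite /column_weight big_ord_recr_lift mulrC snoc_max next_label_max.
congr (_ * _); apply: eq_bigr => i _.
rewrite snoc_lift next_label_lift_max snoc_max.
rewrite (eq_next_label (g := c)) => [|k /=]; last by rewrite snoc_lift.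
by case: next_label.
Qed.

Lemma column_sumS n (L : 'I_n.+1 -> bool) a phi :
  column_sum L a phi =
  \sum_(x | ((x != None) ==> L ord_max) && ((Some a \in stop_labels) ==> (x == None)))
    column_box_weight (L ord_max) a x *
    column_sum (L \o lift ord_max) (odflt a x)
      (fun k => phi (k + live_after (L ord_max) x)%N).
Proof.
rewrite /column_sum big_mkcond sum_snoc [RHS]big_mkcond; apply: eq_bigr => x _.
under eq_bigr => c _ do rewrite column_ok_snoc.
case: ifP => [xok|xnok].
  rewrite mulr_sumr [RHS]big_mkcond; apply: eq_bigr => c _.
  rewrite andbA xok /= column_weight_snoc mulrA; case: ifP => // _.
  rewrite big_ord_recr_lift snoc_max; congr (_ * phi (_ + _)%N).
  by apply: eq_bigr => i _; rewrite snoc_lift.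
by rewrite big1 // => c _; rewrite andbA xnok.
Qed.

Lemma column_sum0 (L : 'I_0 -> bool) a phi : column_sum L a phi = phi 0%N.
Proof.
rewrite /column_sum (big_pred1 [ffun=> None]) => [|c].
  by rewrite /column_weight !big_ord0 mul1r.
rewrite (_ : column_ok L a c); last by apply/column_okP; split=> [i|i|_ i]; case: i.
by apply/esym/eqP/ffunP; case.
Qed.

(** A bottom alpha empties the column, and each box has weight 1 because it sees that alpha below.
    Under a gamma, each live row gives a factor [q] instead. *)
Lemma column_sum_Alpha n (L : 'I_n -> bool) phi :
  column_sum L Alpha phi = phi (\sum_i L i)%N.
Proof.
elim: n L phi => [|n IHn] L phi; first by rewrite column_sum0 big_ord0.
rewrite column_sumS (big_pred1 None) => [|x]; last by case: x => [l|]; rewrite ?andbF.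
by rewrite IHn big_ord_recr_lift /= andbF mul1r.
Qed.

Lemma column_sum_Gamma n (L : 'I_n -> bool) phi :
  column_sum L Gamma phi = q ^+ (\sum_i L i)%N * phi (\sum_i L i)%N.
Proof.
elim: n L phi => [|n IHn] L phi; first by rewrite column_sum0 big_ord0 mul1r.
rewrite column_sumS (big_pred1 None) => [|x]; last by case: x => [l|]; rewrite ?andbF.
rewrite IHn big_ord_recr_lift /= andbT mulrA.
by case: (L _); rewrite ?addn1 ?addn0 ?exprS ?mul1r.
Qed.

(** The terms are the possible contents of the lowest live row: empty (it stays live, hence
    [phi \o succn]), beta (it dies), alpha or gamma. In the last two cases the [k'] live rows above
    are empty, with total weight 1 or [q ^+ k'], and all [k] rows stay live. *)
Fixpoint beta_column (k : nat) (phi : nat -> R) : R :=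
  if k is k'.+1 then
    q * beta_column k' (phi \o succn) + be * beta_column k' phi
    + (al + ga * q ^+ k') * phi k
  else phi 0%N.

Lemma eq_beta_column k phi psi : phi =1 psi -> beta_column k phi = beta_column k psi.
Proof.
elim: k phi psi => [|k IHk] phi psi E //=; rewrite E (IHk _ _ E).
by rewrite (IHk _ (psi \o succn)) // => i /=.
Qed.

Lemma beta_columnZ k a phi :
  beta_column k (fun i => a * phi i) = a * beta_column k phi.
Proof.
elim: k phi => [|k IHk] phi //=; rewrite IHk.
rewrite -[_ \o _]/(fun i => a * (phi \o succn) i) IHk !mulrDr.
by rewrite !(mulrCA a).
Qed.

Lemma column_sum_Beta n (L : 'I_n -> bool) phi :
  column_sum L Beta phi = beta_column (\sum_i L i)%N phi.
Proof.
elim: n L phi => [|n IHn] L phi; first by rewrite column_sum0 big_ord0.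
rewrite column_sumS big_mkcond sum_option_label big_ord_recr_lift /=.
(* A dead lowest row has an empty box of weight 1 and drops out; this is why only the number of live
   rows matters. *)
case: (L ord_max) => /=; last first.
  by rewrite !addr0 addn0 mul1r IHn; apply: eq_beta_column => k; rewrite addn0.
(* The delta term vanishes. An empty box or a beta leaves a beta below the rest of the column, so
   [IHn] covers both. *)
rewrite !mul0r addr0 column_sum_Alpha column_sum_Gamma !IHn !addn1 /=.
rewrite (@eq_beta_column _ (fun k => phi (k + 1)%N) (phi \o succn)) => [|k]; last by rewrite addn1.
rewrite (@eq_beta_column _ (fun k => phi (k + 0)%N) phi) => [|k]; last by rewrite addn0.
by rewrite mulrDl !addrA mulrA -!addrA; congr (_ + _); rewrite addrCA.
Qed.

(* Operators compose on the side opposite to words: [foldr step phi s] applies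
   the letters of [s] from the last one to the first. *)
Definition step (b : bool) (phi : nat -> R) (k : nat) : R :=
  if b then al * phi k.+1 else be * beta_column k phi + ga * (q ^+ k * phi k.+1).


(** * Sums over tableaux of a given type *)

Local Notation weight := (tableau_weight al be ga 0 q).

(** The size [n] is independent of [s], which avoids casts between types of fillings when words are
    concatenated. *)
Definition type_sum n (s : word) (phi : nat -> R) : R :=
  \sum_(T : filling n | staircase_tableau T && (tableau_type T == s))
    weight T * phi (\sum_i live T i)%N.

(* The transfer operators treat rows starting with a delta like those starting
   with a beta; this is harmless because such tableaux have weight 0. *)
Lemma weight_Delta n (T : filling n) i :
  staircase_tableau T -> row_label T i = Some Delta -> weight T = 0.
Proof.
move=> /staircaseP[Tsh _ _ _] /first_label_mem[k Tk].
rewrite /tableau_weight (bigD1 (i, k)) /=; first by rewrite /box_weight Tk mul0r.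
by apply: contraT => /Tsh; rewrite Tk.
Qed.

Lemma prod_in_shape n (F : 'I_n * 'I_n -> R) :
  \prod_(p | in_shape p) F p =
  \prod_i \prod_j if in_shape (i, j) then F (i, j) else 1.
Proof. by rewrite big_mkcond pair_bigA; apply: eq_bigr => [[]]. Qed.

(** Old boxes keep their nearest labels to the right and below, hence their weights; only the new
    column contributes a factor. *)
Lemma weight_add_column n (T : filling n) (c : {ffun 'I_n -> option label}) l :
  staircase_tableau T ->
  weight (add_column T (snoc c (Some l))) =
  weight T * (label_weight al be ga 0 l * column_weight (live T) l c).
Proof.
move=> sT; set U := add_column _ _.
have -> : weight U = weight T *
    (label_weight al be ga 0 l * \prod_i box_weight al be ga 0 q U (lift ord_max i, ord0)).
  rewrite /tableau_weight !prod_in_shape.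
  rewrite big_ord_recr_lift big_ord_recl [X in _ (_ * X) = _]big1 => [|j _]; last first.
    by rewrite (negbTE (in_shape_max j)).
  rewrite mulr1 {2}/in_shape /= addn0 ltnSn {2}/box_weight add_column0 snoc_max.
  rewrite [label_weight _ _ _ _ _ * _ in RHS]mulrC mulrA -big_split /=; congr (_ * _).
  apply: eq_bigr => i _; rewrite big_ord_recl mulrC; congr (_ * _).
    apply: eq_bigr => j _; rewrite in_shape_lift /box_weight add_column_lift /=.
    by rewrite nearest_right_lift nearest_below_lift.
  by rewrite /in_shape addn0 ltn_ord.
(* Rows starting with a delta are set aside: there an empty new box has weight [q], whereas
   [column_box_weight] gives 1. Both sides then vanish with [weight T]. *)
have [/existsP[i /eqP Ti]|noD] := boolP [exists i, row_label T i == Some Delta].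
  by rewrite (weight_Delta sT Ti) !mul0r.
congr (_ * (_ * _)); apply: eq_bigr => i _.
rewrite /box_weight add_column0 snoc_lift; case: (c i) => //=.
rewrite nearest_right0 nearest_below0 /live.
move: noD; rewrite negb_exists => /forallP/(_ i); have := row_label_neq_None i sT.
by case: (row_label T i) => [[]|] //= _ _; case: (odflt l _).
Qed.

Lemma sum_live_add_column n (T : filling n) (c : {ffun 'I_n -> option label}) l :
  (\sum_i live (add_column T (snoc c (Some l))) i =
   \sum_i live_after (live T i) (c i) + (Some l \notin dead_labels))%N.
Proof.
rewrite big_ord_recr_lift {2}/live row_label_max snoc_max; congr (_ + _)%N.
apply: eq_bigr => i _; rewrite /live row_label_lift snoc_lift.
by case: (c i).
Qed.

(** Deleting the first column and the last row inverts [add_column] on staircase tableaux, since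
    their last row is empty outside the first column. *)
Lemma sum_add_column n (P : pred (filling n.+1)) (F : filling n.+1 -> R) :
  \sum_(T | staircase_tableau T && P T) F T =
  \sum_T \sum_(c | staircase_tableau (add_column T c) && P (add_column T c))
    F (add_column T c).
Proof.
rewrite pair_big_dep /=.
rewrite (reindex_onto (fun p : filling n * {ffun 'I_n.+1 -> option label} => add_column p.1 p.2)
  (fun T => ([ffun p => T (lift ord_max p.1, lift ord0 p.2)], [ffun i => T (i, ord0)]))) /=.
  apply: eq_bigl => [[T c]] /=; rewrite andbC.
  rewrite (_ : (_, _) == _) //; apply/eqP; congr (_, _); apply/ffunP.
    by move=> [i j]; rewrite ffunE add_column_lift.
  by move=> i; rewrite ffunE add_column0.
move=> T /andP[/staircaseP[Tsh _ _ _] _]; apply/ffunP => [[i j]].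
case: (unliftP ord0 j) => [j' ->|->]; last by rewrite add_column0 ffunE.
case: (unliftP ord_max i) => [i' ->|->]; first by rewrite add_column_lift ffunE.
by rewrite add_column_max Tsh // in_shape_max.
Qed.

Lemma type_sum_rcons n s b phi :
  type_sum n.+1 (rcons s b) phi = type_sum n s (step b phi).
Proof.
rewrite /type_sum sum_add_column [RHS]big_mkcond; apply: eq_bigr => T _.
rewrite big_mkcond sum_snoc.
case sT: (staircase_tableau T) => /=; last first.
  by rewrite big1 // => x _; rewrite big1 // => c _; rewrite staircase_add_column sT.
(* Contribution of the columns with bottom label [l]; the bottom row itself adds one live row unless
   [l] is dead. *)
have E l : \sum_c (if staircase_tableau (add_column T (snoc c (Some l))) &&
      (tableau_type (add_column T (snoc c (Some l))) == rcons s b)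
    then weight (add_column T (snoc c (Some l))) *
         phi (\sum_i live (add_column T (snoc c (Some l))) i)%N
    else 0) =
  if (tableau_type T == s) && (label_type l == b) then
    weight T * (label_weight al be ga 0 l *
      column_sum (live T) l (fun k => phi (k + (Some l \notin dead_labels))%N))
  else 0.
  under eq_bigr => c _ do
    rewrite staircase_add_column sT type_add_column eqseq_rcons andbC.
  case: ifP => _; last by rewrite big1.
  rewrite /= -big_mkcond !mulr_sumr; apply: eq_bigr => c _.
  by rewrite weight_add_column // sum_live_add_column !mulrA.
rewrite sum_option_label big1 => [|c _]; last first.
  by rewrite staircase_add_column /= andbF.
rewrite add0r !E /=; case: (_ == s) => /=; last by rewrite !addr0.
rewrite column_sum_Alpha column_sum_Beta column_sum_Gamma /step !addn1.
rewrite (@eq_beta_column _ (fun k => phi (k + 0)%N) phi) => [|k]; last by rewrite addn0.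
(* The letter selects alpha and delta, or beta and gamma; the delta term is zero. *)
by case: b {E}; rewrite /= ?mul0r ?mulr0 ?addr0 ?add0r // mulrDr.
Qed.

Lemma type_sum_cat n s1 s2 phi :
  type_sum (n + size s2) (s1 ++ s2) phi = type_sum n s1 (foldr step phi s2).
Proof.
elim/last_ind: s2 phi => [|s2 b IHs] phi; first by rewrite addn0 cats0.
by rewrite size_rcons addnS -rcons_cat type_sum_rcons IHs foldr_rcons.
Qed.

(** Cutting the word anywhere turns the suffix into a function of the number of live rows of the
    prefix tableau, so a local relation between words follows from a pointwise relation between
    operators. *)
Lemma Z_type_sum s1 s2 :
  Z al be ga 0 q (s1 ++ s2) =
  type_sum (size s1) s1 (foldr step (fun=> 1) s2).
Proof.
rewrite -type_sum_cat -size_cat; apply: eq_bigr => T _.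
by rewrite mulr1.
Qed.

(** * The operator relation and the three identities *)

Lemma step_commutation phi k :
  step true (step false phi) k =
  q * step false (step true phi) k + al * be * (step true phi k + step false phi k).
Proof.
(* One unfolding of [beta_column] at [k.+1] suffices: its [q] term and the gamma term of [step] give
   the swapped product, and the rest is the [al * be] term. *)
by rewrite /step /= beta_columnZ -[fun i => phi i.+1]/(phi \o succn) !exprS; ring.
Qed.

Lemma type_sum_size0 phi : type_sum 0 [::] phi = phi 0%N.
Proof.
have T0 (T T' : filling 0) : T = T' by apply/ffunP => [[[]]].
rewrite /type_sum (big_pred1 [ffun=> None]) => [|T].
  by rewrite /tableau_weight big_ord0 big1 ?mul1r // => [[[]]].
rewrite /= [T == _](introT eqP (T0 _ _)) /tableau_type enum_ord0 andbT.
by apply/staircaseP; split=> [[]|||]; case.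
Qed.

Lemma Z_foldr s : Z al be ga 0 q s = foldr step (fun=> 1) s 0%N.
Proof. exact: etrans (Z_type_sum [::] s) (type_sum_size0 _). Qed.

End Transfer.

Theorem theorem4p8 (R : comNzRingType) (al be ga q : R) (s s1 s2 : word) :
  [/\ Z al be ga 0 q (s1 ++ [:: bullet; circ] ++ s2) =
        q * Z al be ga 0 q (s1 ++ [:: circ; bullet] ++ s2)
        + al * be * (Z al be ga 0 q (s1 ++ [:: bullet] ++ s2)
                     + Z al be ga 0 q (s1 ++ [:: circ] ++ s2)),
      al * Z al be ga 0 q (circ :: s) =
        ga * Z al be ga 0 q (bullet :: s) + al * be * Z al be ga 0 q s
    & Z al be ga 0 q (rcons s bullet) = al * Z al be ga 0 q s].
Proof.
split.
- rewrite !Z_type_sum /= !(mulr_sumr, =^~ big_split); apply: eq_bigr => T _.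
  by rewrite step_commutation /=; ring.
(* The first letter acts last, at 0 live rows, where [beta_column 0 phi] is [phi 0]: a circle gives
   [be * phi 0 + ga * phi 1] and a bullet gives [al * phi 1]. *)
- by rewrite !Z_foldr /= /step /= expr0; ring.
(* The last letter acts first, on the constant function 1, which a bullet turns into the constant
   [al]. *)
- rewrite -cats1 Z_type_sum -[X in al * Z _ _ _ _ _ X]cats0 Z_type_sum mulr_sumr.
  by apply: eq_bigr => T _; rewrite /= /step; ring.
Qed.
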